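(* Let $\boldsymbol{A}=[\boldsymbol{a}_1,\ldots,\boldsymbol{a}_N]\in\mathbb{R}^{M\times N}$ and $\boldsymbol{S}=[\boldsymbol{s}_1,\ldots,\boldsymbol{s}_L]\in\mathbb{R}^{N\times L}$ with $N\le\min\{M,L\}$, and assume that (A1) every $\boldsymbol{s}_i$ satisfies $\boldsymbol{s}_i\ge\boldsymbol{0}$ and $\boldsymbol{1}^T\boldsymbol{s}_i=1$; (A2) $\boldsymbol{A}$ has full column rank; (A3) $\boldsymbol{S}$ has full row rank. Let $\boldsymbol{x}_i=\boldsymbol{A}\boldsymbol{s}_i$ for $i=1,\ldots,L$, let $\mathcal{X}=\mathrm{conv}\{\boldsymbol{x}_1,\ldots,\boldsymbol{x}_L\}$, and let $\gamma$ be the uniform pixel purity level of $\boldsymbol{s}_1,\ldots,\boldsymbol{s}_L$. Suppose $N\ge3$ and $\gamma>1/\sqrt{N-1}$. Then $\boldsymbol{A}$ can be exactly recovered (up to the ordering of its columns) from $\boldsymbol{x}_1,\ldots,\boldsymbol{x}_L$ as follows. Let $\mathcal{E}^\star$ be the optimal ellipsoid $\mathcal{E}(\boldsymbol{F},\boldsymbol{c})$ of the problem $$\max_{\boldsymbol{F}\in\mathbb{R}^{M\times(N-1)},\ \boldsymbol{c}\in\mathbb{R}^M}\ \det(\boldsymbol{F}^T\boldsymbol{F})\quad\text{s.t.}\quad \mathcal{E}(\boldsymbol{F},\boldsymbol{c})\subseteq\mathcal{X}.$$ Its center is $\bar{\boldsymbol{a}}=\frac1N\sum_{i=1}^N\boldsymbol{a}_i$,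 the set of contact points $\mathcal{E}^\star\cap(\mathrm{rbd}\,\mathcal{X})$ consists of exactly $N$ points, and for a suitable ordering $\boldsymbol{q}_1,\ldots,\boldsymbol{q}_N$ of these points one has both $$\boldsymbol{a}_i=N\bar{\boldsymbol{a}}-(N-1)\boldsymbol{q}_i,\qquad i=1,\ldots,N,$$ and $$\boldsymbol{a}_i=\sum_{j=1}^N\boldsymbol{q}_j-(N-1)\boldsymbol{q}_i,\qquad i=1,\ldots,N.$$
   Context: For $\boldsymbol{F}\in\mathbb{R}^{m\times n}$ and $\boldsymbol{c}\in\mathbb{R}^m$, $\mathcal{E}(\boldsymbol{F},\boldsymbol{c})=\{\boldsymbol{F}\boldsymbol{\alpha}+\boldsymbol{c} : \boldsymbol{\alpha}\in\mathbb{R}^n,\ \|\boldsymbol{\alpha}\|\le 1\}$, where $\|\cdot\|$ is the Euclidean norm; its center is $\boldsymbol{c}$. $\mathrm{rbd}$ denotes relative boundary. $\boldsymbol{1}$ is the all-one vector, $\boldsymbol{e}_i$ the $i$-th standard unit vector of $\mathbb{R}^N$, $\boldsymbol{s}\ge\boldsymbol{0}$ means element-wise non-negative, and $\mathcal{B}_N=\{\boldsymbol{x}\in\mathbb{R}^N : \|\boldsymbol{x}\|\le1\}$. The uniform pixel purity level is $$\gamma=\max\{r\le1 : (\mathrm{conv}\{\boldsymbol{e}_1,\ldots,\boldsymbol{e}_N\})\cap(r\mathcal{B}_N)\subseteq\mathrm{conv}\{\boldsymbol{s}_1,\ldots,\boldsymbol{s}_L\}\}$$ (read as a supremum in degenerate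 cases where the maximum is not attained). *)

(* Defs.v *)
From HB Require Import structures.
From mathcomp Require Import all_boot all_order all_algebra.
From mathcomp Require Import boolp classical_sets functions reals topology normedtype.

Set Implicit Arguments.
Unset Strict Implicit.
Unset Printing Implicit Defensive.

Import Order.TTheory GRing.Theory Num.Theory.
Import numFieldNormedType.Exports.

Local Open Scope classical_set_scope.
Local Open Scope ring_scope.

(* The library norm on matrices is the maximum norm, hence this definition. *)
Definition enorm (R : realType) (m : nat) (x : 'cV[R]_m) : R :=
  Num.sqrt (\sum_i x i 0 ^+ 2).

Definition unit_ball (R : realType) (m : nat) : set 'cV[R]_m :=
  [set x | enorm x <= 1].
Arguments unit_ball : clear implicits.

Definition ellipsoid (R : realType) (m n : nat) (F : 'M[R]_(m, n))
    (c : 'cV[R]_m) : set 'cV[R]_m :=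
  [set F *m alpha + c | alpha in unit_ball R n].

Definition conv (R : realType) (m k : nat) (v : 'I_k -> 'cV[R]_m) :
    set 'cV[R]_m :=
  [set x | exists w : 'I_k -> R,
     [/\ forall i, 0 <= w i, \sum_i w i = 1 & x = \sum_i w i *: v i]].

Definition aff (R : realType) (m : nat) (X : set 'cV[R]_m) : set 'cV[R]_m :=
  [set x | exists k (v : 'I_k -> 'cV[R]_m) (w : 'I_k -> R),
     [/\ forall i, X (v i), \sum_i w i = 1 & x = \sum_i w i *: v i]].

(* Topological notions refer to the entrywise topology of the library, which is
   the Euclidean one. *)
Definition relint (R : realType) (m : nat) (X : set 'cV[R]_m) :
    set 'cV[R]_m :=
  [set x | aff X x /\ \forall y \near x, aff X y -> X y].

Definition rbd (R : realType) (m : nat) (X : set 'cV[R]_m) : set 'cV[R]_m :=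
  closure X `\` relint X.

(* The set of admissible r contains 0 and is bounded above by 1, so [sup] is
   a genuine supremum. For r < 0, the dilate of the ball by r is the one
   by |r|, which does not affect the supremum. *)
Definition purity (R : realType) (n l : nat) (s : 'I_l -> 'cV[R]_n) : R :=
  sup [set r : R | r <= 1 /\
    conv (fun i : 'I_n => delta_mx i 0) `&`
      [set r *: x | x in unit_ball R n] `<=` conv s].

Definition max_inscribed (R : realType) (m n : nat) (X : set 'cV[R]_m)
    (F : 'M[R]_(m, n)) (c : 'cV[R]_m) : Prop :=
  ellipsoid F c `<=` X /\
  forall (F' : 'M[R]_(m, n)) (c' : 'cV[R]_m),
    ellipsoid F' c' `<=` X -> \det (F'^T *m F') <= \det (F^T *m F).

(* Main.v *)
Require Import Defs.
From HB Require Import structures.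
From mathcomp Require Import all_boot all_order all_algebra.
From mathcomp Require Import boolp classical_sets functions reals topology normedtype.
From mathcomp Require Import ring lra.

Set Implicit Arguments.
Unset Strict Implicit.
Unset Printing Implicit Defensive.

Import Order.TTheory GRing.Theory Num.Theory.
Import numFieldNormedType.Exports.

Local Open Scope classical_set_scope.
Local Open Scope ring_scope.

(** Write N = n + 1. The inscribed ball of the unit simplex T of R^N is the set
    of the y with sum 1 and |y|^2 <= 1/n, so the purity hypothesis puts its
    image under A inside X, while X lies inside A T. Hence everything reduces
    to showing that the inscribed ball is the only ellipsoid of maximal volume
    of T. With U an orthonormal basis of the complement of the all-one vector
    and u_i its rows, an ellipsoid {U H b + y : |b| <= 1} in T satisfies
    |u_i H| <= y_i. Choose an orthogonal Q such that L = H Q is lower triangular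
    with nonnegative diagonal. Cauchy-Schwarz gives <u_i L, u_i> <= y_i |u_i|,
    whose sum over i is tr L <= sqrt (n / N), and the arithmetic-geometric
    mean inequality bounds det L. In the equality case u_i L = lambda_i u_i for
    all i, and the only linear relation sum_i u_i = 0 forces the lambda_i to
    coincide. Contact points are found from
    |y - q_i|^2 = |y|^2 - (1 - 2 y_i) / n, where q_i is the center of facet i
    and y has sum 1. *)

(** * Linear algebra: reflections, triangular form, Gram determinants, the complement of the all-one
    vector *)

Lemma sum_sqrE (R : comPzRingType) n (x : 'cV[R]_n) :
  \sum_i x i 0 ^+ 2 = (x^T *m x) 0 0.
Proof. by rewrite mxE; apply: eq_bigr => i _; rewrite mxE expr2. Qed.

Lemma sum_sqr_orthogonal (R : comPzRingType) m n (Q : 'M[R]_(m, n))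
    (x : 'cV[R]_n) :
  Q^T *m Q = 1%:M -> \sum_i (Q *m x) i 0 ^+ 2 = \sum_i x i 0 ^+ 2.
Proof. by move=> QQ; rewrite !sum_sqrE trmx_mul -mulmxA (mulmxA Q^T) QQ mul1mx. Qed.

Lemma sum_sqr_le0 (R : realDomainType) n (f : 'I_n -> R) :
  \sum_i f i ^+ 2 <= 0 -> forall i, f i = 0.
Proof.
move=> f0 i; have f_ge0 (j : 'I_n) : true -> 0 <= f j ^+ 2 by rewrite sqr_ge0.
apply/eqP; rewrite -sqrf_eq0 (psumr_eq0P f_ge0) //.
by apply: le_anti; rewrite f0 sumr_ge0.
Qed.

(** The vectors [r] and [rho] times the first unit vector have the same length, so the reflection
    along their difference [w] exchanges them. *)
Lemma householder (R : rcfType) n (r : 'rV[R]_n.+1) :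
  exists Q : 'M[R]_n.+1, [/\ Q^T = Q, Q *m Q = 1%:M
    & r *m Q = Num.sqrt (\sum_i r 0 i ^+ 2) *: delta_mx 0 0].
Proof.
set rho := Num.sqrt _.
have [w wE] : exists w, w = r - rho *: delta_mx 0 0 by eexists.
have rr : r *m r^T = (rho ^+ 2)%:M.
  rewrite sqr_sqrtr; last by apply: sumr_ge0 => i _; apply: sqr_ge0.
  rewrite [LHS]mx11_scalar mxE; congr (_%:M).
  by apply: eq_bigr => i _; rewrite mxE expr2.
have rd : r *m (delta_mx 0 0)^T = (r 0 0)%:M.
  by rewrite trmx_delta -colE [LHS]mx11_scalar mxE.
have dd : (delta_mx 0 0 : 'rV[R]_n.+1) *m (delta_mx 0 0)^T = 1%:M.
  by rewrite trmx_delta mul_delta_mx [LHS]mx11_scalar mxE !eqxx.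
have dr : delta_mx 0 0 *m r^T = (r 0 0)%:M.
  by rewrite -[LHS]trmxK trmx_mul trmxK rd tr_scalar_mx.
have wT : w^T = r^T - rho *: (delta_mx 0 0)^T by rewrite wE linearB linearZ.
(* This [k] is half the squared length of [w], so that the reflection along [w] is the identity
   minus [k^-1 *: (w^T *m w)]. *)
have [k kE] : exists k, k = rho ^+ 2 - rho * r 0 0 by eexists.
have rw : r *m w^T = k%:M.
  by rewrite wT mulmxBr -scalemxAr rr rd scale_scalar_mx -raddfB kE.
have ww : w *m w^T = (2 * k)%:M.
  rewrite {1}wE mulmxBl rw -scalemxAl wT mulmxBr -scalemxAr dr dd.
  apply/matrixP => i j; rewrite !ord1 !mxE !mulr1n kE; ring.
(* When k = 0, [r] is already a nonnegative multiple of the first unit vector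
   and the junk value k^-1 = 0 makes the matrix the identity. *)
exists (1%:M - k^-1 *: (w^T *m w)); split.
- by rewrite linearB linearZ /= trmx_mul trmxK tr_scalar_mx.
- rewrite mulmxBl mul1mx mulmxBr mulmx1 -scalemxAl -scalemxAr.
  rewrite -mulmxA (mulmxA w) ww mul_scalar_mx -scalemxAr !scalerA.
  rewrite -scalerBl -addrA -opprD -scalerDl.
    suff -> : k^-1 + (k^-1 - k^-1 * (k^-1 * (2 * k))) = 0 by rewrite scale0r subr0.
  have [-> | k0] := eqVneq k 0; first by rewrite invr0 !mul0r; ring.
  by field.
- rewrite mulmxBr mulmx1 -scalemxAr mulmxA rw mul_scalar_mx scalerA.
  have [k0|k0] := eqVneq k 0.
    have w2 : \sum_i w 0 i ^+ 2 = 0.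
      transitivity ((w *m w^T) 0 0); last by rewrite ww k0 mulr0 mxE mul0rn.
      by rewrite mxE; apply: eq_bigr => i _; rewrite mxE expr2.
    have w0 : w = 0.
      apply/rowP => i; rewrite [RHS]mxE; apply: (sum_sqr_le0 (f := fun i => w 0 i)).
      by rewrite w2.
    by rewrite w0 scaler0 subr0; apply/eqP; rewrite -subr_eq0 -wE w0.
  by rewrite mulVf // scale1r wE opprB addrC subrK.
Qed.

(** Induction on the rows: a reflection turns row 0 into a nonnegative multiple of the first unit
    vector, and the induction hypothesis treats the lower right block. Rectangular matrices are
    covered because [gram_det_gt0] applies this to a transposed tall matrix. *)
Lemma lq_decomposition (R : rcfType) m n (H : 'M[R]_(m, n)) :
  exists Q : 'M[R]_n, [/\ Q^T *m Q = 1%:M, is_trig_mx (H *m Q)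
    & forall (i : 'I_m) (j : 'I_n), i = j :> nat -> 0 <= (H *m Q) i j].
Proof.
elim: m n H => [|m IHm] [|n] H.
- exists 1%:M; split; [by rewrite tr_scalar_mx mul1mx | | by case].
  by apply/is_trig_mxP => -[].
- exists 1%:M; split; [by rewrite tr_scalar_mx mul1mx | | by case].
  by apply/is_trig_mxP => -[].
- exists 1%:M; split; [by rewrite tr_scalar_mx mul1mx | | by move=> ? []].
  by apply/is_trig_mxP => ? [].
have [Q0 [Q0T Q0Q0 rQ0]] := householder (row 0 H).
set rho := Num.sqrt _ in rQ0.
have [H1 H1def] : exists H1 : 'M_(1 + m, 1 + n), H1 = H *m Q0 by eexists.
have [Q1 [Q1Q1 trig1 diag1]] := IHm _ (drsubmx H1).
pose Q : 'M[R]_(1 + n) := Q0 *m (block_mx 1%:M 0 0 Q1 : 'M_(1 + n)).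
have rH1 : row 0 H1 = rho *: delta_mx 0 0 by rewrite H1def row_mul.
have H1_0 (i : 'I_(1 + m)) (j : 'I_(1 + n)) :
    i = 0%N :> nat -> H1 i j = rho * (j == 0%N :> nat)%:R.
  move=> i0; have -> : i = 0 :> 'I_m.+1 by apply: val_inj.
  by move/rowP/(_ j): rH1; rewrite 3!mxE eqxx.
have H1E : H1 = block_mx rho%:M 0 (dlsubmx H1) (drsubmx H1).
  rewrite -[LHS]submxK; congr block_mx.
    by rewrite [LHS]mx11_scalar 2!mxE H1_0 //= mulr1.
  by apply/matrixP => i j; rewrite ord1 3!mxE H1_0 //= mulr0.
have HQ : H *m Q = block_mx rho%:M 0 (dlsubmx H1) (drsubmx H1 *m Q1).
  rewrite mulmxA -H1def {1}H1E.
  apply: (etrans (mulmx_block (_ : 'M_1) _ _ _ _ _ _ _)).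
  by rewrite !(mulmx1, mulmx0, mul0mx, addr0, add0r).
have diagQ (i : 'I_(1 + m)) (j : 'I_(1 + n)) : i = j :> nat ->
    0 <= block_mx rho%:M 0 (dlsubmx H1) (drsubmx H1 *m Q1) i j.
  case: (split_ordP i) => i' ->; case: (split_ordP j) => j' ->.
  - by rewrite block_mxEul !ord1 mxE mulr1n sqrtr_ge0.
  - by rewrite ord1.
  - by rewrite ord1.
  - by rewrite block_mxEdr /= => -[]; apply: diag1.
exists Q; split.
- rewrite trmx_mul -mulmxA (mulmxA Q0^T) Q0T Q0Q0 mul1mx.
  rewrite (tr_block_mx (1%:M : 'M_1) 0 0 Q1).
  apply: (etrans (@mulmx_block _ 1 n 1 n 1 n _ _ _ _ _ _ _ _)).
  rewrite !(trmx1, trmx0, mulmx1, mulmx0, mul0mx, addr0, add0r) Q1Q1.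
  exact: esym (scalar_mx_block _ _ _).
- rewrite HQ (@is_trig_block_mx _ 1 m 1 n) // eqxx trig1 andbT /=.
  by apply/is_trig_mxP => i j; rewrite !ord1.
- rewrite HQ => i j; apply: diagQ.
Qed.

Lemma left_inverse_of_rank (F : fieldType) m n (A : 'M[F]_(m, n)) :
  \rank A = n -> exists B, B *m A = 1%:M.
Proof.
move=> rkA; have /row_freeP[B AB] : row_free A^T.
  by rewrite -row_leq_rank mxrank_tr rkA.
by exists B^T; apply: trmx_inj; rewrite trmx_mul trmxK AB tr_scalar_mx.
Qed.

(** A kernel vector of the Gram matrix is sent by [W] to a vector of length 0, so full column rank
    makes the determinant nonzero. For the sign, a triangular form of [W^T] exhibits it as a
    square. *)
Lemma gram_det_gt0 (R : rcfType) m n (W : 'M[R]_(m, n)) :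
  \rank W = n -> 0 < \det (W^T *m W).
Proof.
move=> rkW; have nm : (n <= m)%N by rewrite -rkW rank_leq_row.
have det_neq0 : \det (W^T *m W) != 0.
  apply/det0P => -[v /negP v_neq0 vWW]; apply: v_neq0.
  have WvT : \sum_i (W *m v^T) i 0 ^+ 2 <= 0.
    by rewrite sum_sqrE trmx_mul trmxK mulmxA -(mulmxA v) vWW mul0mx mxE.
  have {}WvT : v *m W^T = 0.
    apply: trmx_inj; rewrite trmx_mul trmxK trmx0; apply/colP => i.
    by rewrite [RHS]mxE; exact: (sum_sqr_le0 (f := fun i => (W *m v^T) i 0)).
  have /row_free_inj inj : row_free W^T by rewrite -row_leq_rank mxrank_tr rkW.
  by apply/eqP; apply: (inj 1%N); rewrite WvT mul0mx.
rewrite lt_def det_neq0 /=.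
(* With this splitting the triangular form of [W^T] is a square block followed by a zero block, and
   the Gram determinant is the squared determinant of the former. *)
have [k mE] : exists k, m = (n + k)%N by exists (m - n)%N; rewrite subnKC.
move: W {rkW nm det_neq0}; rewrite mE => W.
have [Q [QQ trig _]] := lq_decomposition W^T.
pose T := W^T *m Q.
have QQT : Q *m Q^T = 1%:M by apply: mulmx1C.
have -> : W^T *m W = T *m T^T by rewrite trmx_mul trmxK mulmxA -(mulmxA W^T) QQT mulmx1.
have T0 : rsubmx T = 0.
  apply/matrixP => i j; rewrite mxE [RHS]mxE.
  by move/is_trig_mxP: trig; apply; rewrite /= ltn_addr.
rewrite -[T]hsubmxK T0 tr_row_mx mul_row_col mul0mx addr0.
by rewrite det_mulmx det_tr -expr2 sqr_ge0.
Qed.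

(** Take the symmetric reflection that sends the all-one row to a multiple of the first unit vector.
    Its first column is constant, equal to the inverse of the square root of n + 1, and [U] consists
    of the other columns. *)
Lemma ones_complement_basis (R : rcfType) n :
  exists U : 'M[R]_(n.+1, n),
    U^T *m U = 1%:M /\ U *m U^T = 1%:M - const_mx n.+1%:R^-1.
Proof.
have [Q [QT QQ rQ]] := householder (const_mx 1 : 'rV[R]_n.+1).
set c := Num.sqrt _ in rQ.
have c2 : c ^+ 2 = n.+1%:R.
  rewrite sqr_sqrtr; last by apply: sumr_ge0 => i _; apply: sqr_ge0.
  rewrite (eq_bigr (fun=> 1)) ?sumr_const ?card_ord // => i _.
  by rewrite mxE expr1n.
have c0 : c != 0 by rewrite -sqrf_eq0 c2 pnatr_eq0.
have Q0 j : Q 0 j = c^-1.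
  have : const_mx 1 *m Q *m Q = const_mx 1 :> 'rV_n.+1 by rewrite -mulmxA QQ mulmx1.
  rewrite rQ -scalemxAl -rowE => /rowP/(_ j); rewrite !mxE => cQ.
  by apply: (mulfI c0); rewrite cQ divff.
have Qsym i j : Q i j = Q j i by rewrite -{1}QT mxE.
have sumQ i j : \sum_k Q i k * Q k j = (i == j)%:R.
  by move/matrixP/(_ i j): QQ; rewrite !mxE.
exists (\matrix_(i, j) Q i (lift 0 j)); split; apply/matrixP => i j.
  rewrite !mxE; transitivity (\sum_k Q (lift 0 i) k * Q k (lift 0 j)).
    by apply: eq_bigr => k _; rewrite !mxE Qsym.
  by rewrite sumQ (inj_eq lift_inj).
have := sumQ i j; rewrite big_ord_recl Qsym !Q0 -expr2 exprVn c2 !mxE => <-.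
rewrite addrC addKr; apply: eq_bigr => k _.
by rewrite !mxE (Qsym j).
Qed.

Lemma complement_basis_ones (R : numFieldType) n (U : 'M[R]_(n.+1, n)) :
    U^T *m U = 1%:M -> U *m U^T = 1%:M - const_mx n.+1%:R^-1 ->
  U^T *m const_mx 1 = 0 :> 'cV_n.
Proof.
move=> UU UUT.
have UJ : U^T *m const_mx n.+1%:R^-1 = 0 :> 'M_(n, n.+1).
  have := congr1 (mulmx U^T) UUT; rewrite mulmxA UU mul1mx mulmxBr mulmx1.
  by move/eqP; rewrite -subr_eq0 opprB addrC subrK => /eqP.
have -> : const_mx 1 = n.+1%:R *: const_mx n.+1%:R^-1 :> 'cV[R]_n.+1.
  by apply/colP => i; rewrite !mxE divff // pnatr_eq0.
rewrite -scalemxAr; apply/colP => i; have /matrixP/(_ i 0) := UJ.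
rewrite !mxE => Ui0; rewrite (_ : \sum_j _ = 0) ?mulr0 // -[RHS]Ui0.
by apply: eq_bigr => j _; rewrite !mxE.
Qed.

(** * Ellipsoids inside the unit simplex: the volume bound and its equality case *)

(** The minimum of the affine function over the unit ball is a - |g|, attained at -g/|g|. For g = 0
    the convention [0^-1 = 0] turns this minimizer into the origin. *)
Lemma halfspace_ball (R : rcfType) n (g : 'I_n -> R) (a : R) :
    (forall b : 'cV[R]_n, \sum_i b i 0 ^+ 2 <= 1 ->
       0 <= \sum_i g i * b i 0 + a) ->
  0 <= a /\ \sum_i g i ^+ 2 <= a ^+ 2.
Proof.
move=> ball_ge0.
have g2_ge0 : 0 <= \sum_i g i ^+ 2 by apply: sumr_ge0 => i _; apply: sqr_ge0.
pose s := Num.sqrt (\sum_i g i ^+ 2).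
have s2 : s ^+ 2 = \sum_i g i ^+ 2 by rewrite sqr_sqrtr.
have s_ge0 : 0 <= s by rewrite sqrtr_ge0.
have s_le : s <= a.
  pose b : 'cV[R]_n := \col_i (- s^-1 * g i).
  have b2 : \sum_i b i 0 ^+ 2 = s^-1 ^+ 2 * s ^+ 2.
    by rewrite s2 mulr_sumr; apply: eq_bigr => i _; rewrite mxE exprMn sqrrN.
  have gb : \sum_i g i * b i 0 = - s^-1 * s ^+ 2.
    by rewrite s2 mulr_sumr; apply: eq_bigr => i _; rewrite mxE; ring.
  have := ball_ge0 b; rewrite b2 gb.
  have [-> | s0] := eqVneq s 0.
    by rewrite invr0 oppr0 !expr0n !mul0r add0r ler01; apply.
  have -> : s^-1 ^+ 2 * s ^+ 2 = 1 by field.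
  have -> : - s^-1 * s ^+ 2 = - s by field.
  by rewrite lexx addrC subr_ge0; apply.
split; first exact: le_trans s_le.
by rewrite -s2 ler_sqr // nnegrE (le_trans s_ge0).
Qed.

(** Here [rho] is the inradius of the simplex, and its equation excludes [n = 0]. In the equality
    case [H] is known only up to an orthogonal factor, which does not change the ellipsoid. *)
Lemma simplex_inscribed_ellipsoid (R : rcfType) n (U : 'M[R]_(n.+1, n))
    (H : 'M[R]_n) (y : 'cV[R]_n.+1) (rho : R) :
    U^T *m U = 1%:M -> U *m U^T = 1%:M - const_mx n.+1%:R^-1 ->
    0 < rho -> rho ^+ 2 * (n%:R * n.+1%:R) = 1 -> \sum_i y i 0 = 1 ->
    (forall b : 'cV[R]_n, \sum_i b i 0 ^+ 2 <= 1 ->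
       forall i, 0 <= (U *m H *m b + y) i 0) ->
  \det H ^+ 2 <= rho ^+ n ^+ 2 /\
  (rho ^+ n ^+ 2 <= \det H ^+ 2 ->
     y = const_mx n.+1%:R^-1 /\
     exists Q : 'M[R]_n, Q^T *m Q = 1%:M /\ H = rho *: Q).
Proof.
move=> UU UUT rho_gt0 rho2 y1 ball_ge0.
have n_gt0 : (0 < n)%N.
  case: n rho2 {U H y UU UUT y1 ball_ge0} => // /eqP.
  by rewrite mul0r mulr0 eq_sym oner_eq0.
have nR_gt0 : 0 < n%:R :> R by rewrite ltr0n.
have [Q [QQ /is_trig_mxP trig diag]] := lq_decomposition H.
have QQT : Q *m Q^T = 1%:M by apply: mulmx1C.
have [L LE] : exists L, L = H *m Q by eexists.
rewrite -LE in trig diag.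
have HE : H = L *m Q^T by rewrite LE -mulmxA QQT mulmx1.
have detH : \det H ^+ 2 = \det L ^+ 2.
  rewrite HE det_mulmx exprMn (expr2 (\det Q^T)) {2}det_tr -det_mulmx.
  by rewrite mulmx1C // det1 mulr1.
pose g i k := (U *m L) i k.
pose t i := \sum_k g i k * U i k.
have ball i : 0 <= y i 0 /\ \sum_k g i k ^+ 2 <= y i 0 ^+ 2.
  apply: halfspace_ball => b b1.
  have := ball_ge0 (Q *m b) _ i; rewrite sum_sqr_orthogonal // => /(_ b1).
  rewrite mulmxA -(mulmxA U) -LE mxE; congr (0 <= _ + _).
  by rewrite mxE.
(* Row i of [U] has squared length 1 - 1/(n + 1), and this is (n rho)^2 because rho^2 = 1/(n (n +
   1)). *)
have U2 i : \sum_k U i k ^+ 2 = (n%:R * rho) ^+ 2.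
  transitivity ((U *m U^T) i i).
    by rewrite mxE; apply: eq_bigr => k _; rewrite mxE expr2.
  rewrite UUT !mxE eqxx mulr1n exprMn.
  have N0 : n%:R + 1 != 0 :> R by rewrite lt0r_neq0 // addr_gt0.
  have -> : rho ^+ 2 = (n%:R * n.+1%:R)^-1 by apply: divr1_eq; rewrite invrK.
  rewrite -natr1; field.
  by rewrite N0 lt0r_neq0.
have tL : \sum_i t i = \tr L.
  transitivity (\tr (U *m L *m U^T)).
    apply: eq_bigr => i _; rewrite [RHS]mxE; apply: eq_bigr => k _.
    by rewrite [X in _ = _ * X]mxE.
  by rewrite mxtrace_mulC mulmxA UU mul1mx.
pose lam i := y i 0 / (n%:R * rho).
have nrho_gt0 : 0 < n%:R * rho by rewrite mulr_gt0.
have y_lam i : y i 0 = lam i * (n%:R * rho) by rewrite divfK // lt0r_neq0.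
(* Expand the square and use |g_i|^2 <= y_i^2. This single estimate gives the Cauchy-Schwarz bound
   [t_le] and, once the slack on the right vanishes, its equality case [gE]. *)
have dist i : \sum_k (g i k - lam i * U i k) ^+ 2 <=
    2 * lam i * (y i 0 * (n%:R * rho) - t i).
  have -> : \sum_k (g i k - lam i * U i k) ^+ 2 =
      \sum_k g i k ^+ 2 - 2 * lam i * t i + lam i ^+ 2 * \sum_k U i k ^+ 2.
    rewrite /t !mulr_sumr -sumrB -big_split /=; apply: eq_bigr => k _; ring.
  rewrite U2 -exprMn -y_lam.
  have [_ g2] := ball i.
  have -> : 2 * lam i * (y i 0 * (n%:R * rho) - t i) =
    2 * (y i 0) ^+ 2 - 2 * lam i * t i by rewrite [in RHS]expr2 {3}y_lam; ring.
  lra.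
have t_le i : t i <= y i 0 * (n%:R * rho).
  have [y_ge0 g2] := ball i.
  (* If y_i = 0 then lam_i = 0 and [dist] says nothing about t_i, but then g_i itself vanishes. *)
  have [y0 | y0] := eqVneq (y i 0) 0.
    move: g2; rewrite y0 expr0n mul0r /= => /sum_sqr_le0 g0.
    by rewrite /t big1 // => k _; rewrite g0 mul0r.
  have lam_gt0 : 0 < 2 * lam i by rewrite !mulr_gt0 ?invr_gt0 // lt_def y0.
  rewrite -subr_ge0 -(pmulr_rge0 _ lam_gt0).
  by apply: le_trans (dist i); apply: sumr_ge0 => k _; apply: sqr_ge0.
have trL_le : \tr L <= n%:R * rho.
  have -> : n%:R * rho = \sum_i y i 0 * (n%:R * rho) by rewrite -mulr_suml y1 mul1r.
  by rewrite -tL; apply: ler_sum => i _.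
have detL : \det L = \prod_i L i i by apply: det_trig; apply/is_trig_mxP.
have detL_ge0 : 0 <= \det L by rewrite detL prodr_ge0 // => i _; apply: diag.
have detL_le : \det L <= (\tr L / n%:R) ^+ n.
  rewrite detL.
  have := @leif_AGM R 'I_n predT (fun i => L i i) (fun i _ => diag i i erefl).
  by rewrite card_ord => /leifP; case: ifP => _ => [/eqP -> | /ltW].
have trL_ge0 : 0 <= \tr L by apply: sumr_ge0 => i _; apply: diag.
have rhon_ge0 : 0 <= rho ^+ n by rewrite exprn_ge0 // ltW.
split.
  rewrite detH ler_sqr ?nnegrE //; apply: le_trans detL_le _.
  apply: lerXn2r; rewrite ?nnegrE ?divr_ge0 ?(ltW rho_gt0) ?(ltW nR_gt0) //.
  by rewrite ler_pdivrMr // mulrC.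
(* From rho^n <= det L <= (tr L / n)^n follows n rho <= tr L. The nonnegative slacks then sum to 0,
   so each of them is 0. *)
rewrite detH ler_sqr ?nnegrE // => /le_trans/(_ detL_le).
rewrite ler_pXn2r ?nnegrE ?divr_ge0 ?(ltW rho_gt0) ?(ltW nR_gt0) //.
rewrite ler_pdivlMr // mulrC => trL_ge.
have slack_ge0 (i : 'I_n.+1) : true -> 0 <= y i 0 * (n%:R * rho) - t i.
  by rewrite subr_ge0 t_le.
have slack0 : \sum_i (y i 0 * (n%:R * rho) - t i) = 0.
  by rewrite sumrB -mulr_suml y1 mul1r tL; apply/eqP; rewrite subr_eq0 eq_le trL_ge.
have gE i k : g i k = lam i * U i k.
  apply/eqP; rewrite -subr_eq0; apply/eqP.
  apply: (sum_sqr_le0 (f := fun k => g i k - lam i * U i k)).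
  by apply: le_trans (dist i) _; rewrite (psumr_eq0P slack_ge0 slack0) ?mulr0.
have U1 := complement_basis_ones UU UUT.
(* Summing g_ik = lam_i U_ik over i identifies this product with L^T U^T 1, which is 0. *)
have lamU : U^T *m (\col_i lam i) = 0.
  rewrite -(mulmx0 _ L^T) -U1 mulmxA -trmx_mul; apply/colP => k.
  rewrite !mxE; apply: eq_bigr => i _; rewrite !mxE.
  by rewrite mulr1 mulrC -gE /g mxE.
(* Since U U^T is the identity minus averaging, every lam_i equals the mean of the lam_j, and the
   entries of [y] summing to 1 gives the mean the value rho. *)
have lam_rho i : lam i = rho.
  have : (U *m (U^T *m (\col_i lam i))) i 0 = 0 by rewrite lamU mulmx0 mxE.
  rewrite mulmxA UUT mulmxBl mul1mx !mxE => /eqP; rewrite subr_eq0 => /eqP ->.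
  under eq_bigr do rewrite !mxE.
  rewrite -mulr_sumr /lam -mulr_suml y1 mul1r.
  have -> : (n%:R * rho)^-1 = rho * n.+1%:R.
    apply: (mulfI (lt0r_neq0 nrho_gt0)); rewrite divff ?lt0r_neq0 //.
    by rewrite -[LHS]rho2; ring.
  by rewrite mulrCA mulVf ?mulr1 // pnatr_eq0.
split.
  apply/colP => i; rewrite y_lam lam_rho mxE.
  apply: (mulIf (_ : n.+1%:R != 0)); rewrite ?pnatr_eq0 // mulVf ?pnatr_eq0 //.
  by rewrite -[RHS]rho2; ring.
exists Q^T; rewrite trmxK; split=> //.
suff LE' : L = rho%:M by rewrite HE LE' mul_scalar_mx.
rewrite -[LHS]mul1mx -UU -mulmxA (_ : U *m L = rho *: U) -?scalemxAr ?UU ?scalemx1 //.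
by apply/matrixP => i k; rewrite -/(g i k) gE lam_rho mxE.
Qed.

(** * Convex and affine hulls, pixel purity, relative interior *)

Lemma enorm_le (R : realType) m (x : 'cV[R]_m) r :
  0 <= r -> (enorm x <= r) = (\sum_i x i 0 ^+ 2 <= r ^+ 2).
Proof.
move=> r_ge0; rewrite -ler_sqr ?nnegrE ?sqrtr_ge0 // sqr_sqrtr //.
by apply: sumr_ge0 => i _; apply: sqr_ge0.
Qed.

Lemma unit_ballP (R : realType) m (x : 'cV[R]_m) :
  unit_ball R m x <-> \sum_i x i 0 ^+ 2 <= 1.
Proof. by rewrite /unit_ball /= enorm_le // expr1n. Qed.

Definition simplex (R : realType) n : set 'cV[R]_n :=
  [set y | (forall i, 0 <= y i 0) /\ \sum_i y i 0 = 1].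

Lemma simplex_conv (R : realType) n (y : 'cV[R]_n) :
  simplex y -> conv (fun i : 'I_n => delta_mx i 0) y.
Proof.
move=> [y_ge0 y1]; exists (fun i => y i 0); split=> //.
by rewrite {1}[y]matrix_sum_delta; apply: eq_bigr => i _; rewrite big_ord1.
Qed.

Lemma conv_sub_simplex (R : realType) n l (s : 'I_l -> 'cV[R]_n) :
  (forall i, simplex (s i)) -> conv s `<=` @simplex R n.
Proof.
move=> s_simplex y [w [w_ge0 w1 ->]]; split=> [i|].
  rewrite summxE sumr_ge0 // => k _; rewrite mxE mulr_ge0 //.
  by case: (s_simplex k).
under eq_bigr do rewrite summxE.
rewrite exchange_big /= -w1; apply: eq_bigr => k _.
under eq_bigr do rewrite mxE.
by rewrite -mulr_sumr; case: (s_simplex k) => _ ->; rewrite mulr1.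
Qed.

Lemma conv_mulmx (R : realType) m n l (A : 'M[R]_(m, n)) (s : 'I_l -> 'cV[R]_n) :
  conv (fun i => A *m s i) = [set A *m y | y in conv s].
Proof.
apply/seteqP; split=> x.
  move=> [w [w_ge0 w1 ->]]; exists (\sum_i w i *: s i); first by exists w.
  by rewrite mulmx_sumr; apply: eq_bigr => i _; rewrite -scalemxAr.
move=> [_ [w [w_ge0 w1 ->]] <-]; exists w; split=> //.
by rewrite mulmx_sumr; apply: eq_bigr => i _; rewrite -scalemxAr.
Qed.

Lemma aff_sub_mulmx (R : realType) m n (A : 'M[R]_(m, n)) (X : set 'cV[R]_m) :
    (X `<=` [set A *m y | y in [set y : 'cV[R]_n | \sum_i y i 0 = 1]]) ->
  aff X `<=` [set A *m y | y in [set y : 'cV[R]_n | \sum_i y i 0 = 1]].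
Proof.
move=> subX x [k [v [w [Xv w1 ->]]]].
have /choice[y y1] : forall i, exists y : 'cV[R]_n, \sum_j y j 0 = 1 /\ A *m y = v i.
  by move=> i; have [y] := subX _ (Xv i); exists y.
exists (\sum_i w i *: y i) => /=.
  under eq_bigr do rewrite summxE.
  rewrite exchange_big /= -w1; apply: eq_bigr => i _.
  under eq_bigr do rewrite mxE.
  by rewrite -mulr_sumr; case: (y1 i) => -> _; rewrite mulr1.
rewrite mulmx_sumr; apply: eq_bigr => i _.
by rewrite -scalemxAr; case: (y1 i) => _ ->.
Qed.

Lemma sub_aff (R : realType) m (X : set 'cV[R]_m) : X `<=` aff X.
Proof.
move=> x Xx; exists 1%N, (fun=> x), (fun=> 1); split=> //.
  by rewrite big_ord1.
by rewrite big_ord1 scale1r.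
Qed.

Lemma aff_line (R : realType) m (X : set 'cV[R]_m) x z t :
  X x -> X z -> aff X (x + t *: (x - z)).
Proof.
move=> Xx Xz.
exists 2%N, (fun i => if i == 0 then x else z),
  (fun i => if i == 0 then 1 + t else - t).
split=> [i||].
- by case: ifP.
- by rewrite big_ord_recl big_ord1 /= addrK.
- by rewrite big_ord_recl big_ord1 /= scalerDl scale1r scaleNr scalerBr addrA.
Qed.

(** The supremum may fail to be attained, but some admissible radius still exceeds [r0]. This strict
    margin later makes the ball points with positive coordinates relatively interior. *)
Lemma purity_ball (R : realType) n l (s : 'I_l -> 'cV[R]_n) r0 :
    0 <= r0 -> r0 < purity s ->
  exists2 r, r0 < r & forall y, simplex y -> \sum_i y i 0 ^+ 2 <= r ^+ 2 ->
    conv s y.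
Proof.
move=> r0_ge0; rewrite /purity; set D := [set _ | _] => r0_lt.
(* The supremum of the empty set is 0 by convention, which contradicts [0 <= r0 < sup D]. *)
have D0 : D !=set0.
  by apply/set0P/negP => /eqP D0; move: r0_lt; rewrite D0 sup0 ltNge r0_ge0.
have [r [_ Dr] r0r] := sup_gt D0 r0_lt.
exists r => // y y_simplex y_le; apply: Dr; split; first exact: simplex_conv.
have r_gt0 : 0 < r by apply: le_lt_trans r0r.
exists (r^-1 *: y); last by rewrite scalerA divff ?scale1r // lt0r_neq0.
apply/unit_ballP; under eq_bigr do rewrite mxE exprMn.
by rewrite -mulr_sumr exprVn mulrC ler_pdivrMr ?exprn_gt0 // mul1r.
Qed.

(** The points just beyond [x] on the line from [z] stay in the affine hull and tend to [x], yet lie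
    outside [X]. *)
Lemma not_relint_of_line (R : realType) m (X : set 'cV[R]_m) x z :
    X x -> X z -> (forall t, 0 < t -> ~ X (x + t *: (x - z))) ->
  ~ relint X x.
Proof.
move=> Xx Xz leaves [_ nearx].
have cvgx : x + t *: (x - z) @[t --> (0 : R)] --> x.
  rewrite -[X in _ --> X]addr0 -(scale0r (x - z)).
  by apply: cvgD; [exact: cvg_cst | apply: cvgZ; [exact: cvg_id | exact: cvg_cst]].
have /nbhs_ballP[e /= e_gt0 ball_e] := cvgx _ nearx.
have e2 : 0 < e / 2 by rewrite divr_gt0.
apply: (leaves (e / 2) e2); apply: ball_e; last exact: aff_line.
rewrite /ball /= sub0r normrN gtr0_norm //.
by rewrite ltr_pdivrMr // ltr_pMr // ltr1n.
Qed.

(** The left inverse [B] recovers coordinates continuously, so positivity and the strict norm bound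
    persist near [A *m y]. A nearby point of the affine hull is the image of its own coordinates,
    which sum to 1, and hence lies in [X]. *)
Lemma relint_mulmx (R : realType) m n (A : 'M[R]_(m, n)) (B : 'M[R]_(n, m))
    (X : set 'cV[R]_m) (y : 'cV[R]_n) r :
    B *m A = 1%:M ->
    (X `<=` [set A *m y | y in [set y : 'cV[R]_n | \sum_i y i 0 = 1]]) ->
    (forall y, simplex y -> \sum_i y i 0 ^+ 2 <= r -> X (A *m y)) ->
    (forall i, 0 < y i 0) -> \sum_i y i 0 = 1 -> \sum_i y i 0 ^+ 2 < r ->
  relint X (A *m y).
Proof.
move=> BA subX Xball y_gt0 y1 y_lt.
have XAy : X (A *m y).
  by apply: Xball; [split=> // i; exact: ltW | exact: ltW].
split; first exact: sub_aff.
have BAy : B *m (A *m y) = y by rewrite mulmxA BA mul1mx.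
have cvgB i : (B *m w) i 0 @[w --> A *m y] --> y i 0.
  have -> : y i 0 = \sum_k B i k * (A *m y) k 0 by rewrite -{1}BAy mxE.
  under eq_fun do rewrite mxE.
  apply: (@cvg_big _ _ _ _ _ _ _ (nbhs (A *m y))) => [|k _].
    exact: add_continuous.
  by apply: cvgM; [exact: cvg_cst | exact: coord_continuous].
have near_gt0 : \forall w \near A *m y, forall i, 0 < (B *m w) i 0.
  apply: (@filter_forall _ _ _ (nbhs (A *m y))) => i.
  exact: (cvgr_gt (y i 0) (cvgB i) _ (y_gt0 i)).
have cvgB2 : \sum_i (B *m w) i 0 ^+ 2 @[w --> A *m y] --> \sum_i y i 0 ^+ 2.
  apply: (@cvg_big _ _ _ _ _ _ _ (nbhs (A *m y))) => [|k _].
    exact: add_continuous.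
  by under eq_fun do rewrite expr2; rewrite expr2; apply: cvgM.
have near_lt : \forall w \near A *m y, \sum_i (B *m w) i 0 ^+ 2 < r.
  exact: (cvgr_lt _ cvgB2 _ y_lt).
near=> w => /(aff_sub_mulmx subX)[v v1 vw]; rewrite -vw.
have Bw : B *m w = v by rewrite -vw mulmxA BA mul1mx.
apply: Xball; rewrite -Bw.
  by split=> [i|]; [apply: ltW; move: i; near: w | rewrite Bw].
by apply: ltW; near: w.
Unshelve. all: by end_near. Qed.

(** * The inscribed ball of the simplex and the centers of the facets *)

Lemma sum_entriesE (R : comPzRingType) n (x : 'cV[R]_n) :
  \sum_i x i 0 = ((const_mx 1 : 'rV_n) *m x) 0 0.
Proof. by rewrite mxE; apply: eq_bigr => i _; rewrite mxE mul1r. Qed.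

(** With y = rho U b + z, z the barycenter, orthogonality gives |y|^2 = rho^2 |b|^2 + 1/(n + 1), and
    rho^2 + 1/(n + 1) = 1/n. *)
Lemma ball_ellipsoid (R : realType) m n (A : 'M[R]_(m, n.+1))
    (U : 'M[R]_(n.+1, n)) rho :
    U^T *m U = 1%:M -> U *m U^T = 1%:M - const_mx n.+1%:R^-1 ->
    0 < rho -> rho ^+ 2 * (n%:R * n.+1%:R) = 1 ->
  ellipsoid (rho *: (A *m U)) (A *m const_mx n.+1%:R^-1) =
    [set A *m y | y in [set y : 'cV[R]_n.+1 |
       \sum_i y i 0 = 1 /\ \sum_i y i 0 ^+ 2 <= n%:R^-1]].
Proof.
move=> UU UUT rho_gt0 rho2.
have N0 : n.+1%:R != 0 :> R by rewrite pnatr_eq0.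
have n0 : n%:R != 0 :> R.
  by apply: contra_eq_neq rho2 => ->; rewrite mul0r mulr0 eq_sym oner_eq0.
have U1 : (const_mx 1 : 'rV_n.+1) *m U = 0.
  apply: trmx_inj; rewrite trmx_mul trmx_const trmx0.
  exact: complement_basis_ones.
have nV : n%:R^-1 = rho ^+ 2 + n.+1%:R^-1.
  have -> : rho ^+ 2 = (n%:R * n.+1%:R)^-1 by apply: divr1_eq; rewrite invrK.
  by move: N0; rewrite -natr1 => N0; field; rewrite N0.
pose Y (b : 'cV[R]_n) := U *m (rho *: b) + const_mx n.+1%:R^-1.
have AY b : (rho *: (A *m U)) *m b + A *m const_mx n.+1%:R^-1 = A *m Y b.
  by rewrite mulmxDr mulmxA -scalemxAl -scalemxAr.
have sumU (b : 'cV[R]_n) : \sum_i (U *m b) i 0 = 0.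
  by rewrite sum_entriesE mulmxA U1 mul0mx mxE.
have Y1 b : \sum_i Y b i 0 = 1.
  under eq_bigr do rewrite mxE.
  rewrite big_split /= sumU add0r; under eq_bigr do rewrite mxE.
  by rewrite sumr_const card_ord -[LHS]mulr_natr mulVf.
have Y2 b : \sum_i Y b i 0 ^+ 2 = rho ^+ 2 * (\sum_i b i 0 ^+ 2 - 1) + n%:R^-1.
  transitivity (\sum_i ((U *m (rho *: b)) i 0 ^+ 2 +
      n.+1%:R^-1 * (2 * (U *m (rho *: b)) i 0 + n.+1%:R^-1))).
    by apply: eq_bigr => i _; rewrite mxE [X in _ + X]mxE; ring.
  rewrite big_split /= -mulr_sumr big_split /= -mulr_sumr sumU mulr0 add0r.
  rewrite sum_sqr_orthogonal // sumr_const card_ord -[_^-1 *+ _]mulr_natr mulVf // mulr1.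
  have -> : \sum_i (rho *: b) i 0 ^+ 2 = rho ^+ 2 * \sum_i b i 0 ^+ 2.
    by rewrite mulr_sumr; apply: eq_bigr => i _; rewrite mxE exprMn.
  by rewrite nV; ring.
have rho2_gt0 : 0 < rho ^+ 2 by rewrite exprn_gt0.
apply/seteqP; split=> [x [b /unit_ballP b1 <-] | x [y [y1 y2] <-]].
  exists (Y b) => //; split=> //.
  by rewrite Y2 gerDr pmulr_rle0 // subr_le0.
(* For entries of sum 1, U U^T y is y minus the barycenter, hence the preimage rho^-1 U^T y. *)
have Jy : const_mx n.+1%:R^-1 *m y = const_mx n.+1%:R^-1 :> 'cV[R]_n.+1.
  apply/colP => i; rewrite !mxE; transitivity (\sum_j n.+1%:R^-1 * y j 0).
    by apply: eq_bigr => j _; rewrite mxE.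
  by rewrite -mulr_sumr y1 mulr1.
have Yy : Y (rho^-1 *: (U^T *m y)) = y.
  rewrite /Y scalerA divff ?lt0r_neq0 // scale1r mulmxA UUT mulmxBl mul1mx.
  by rewrite Jy subrK.
exists (rho^-1 *: (U^T *m y)); last by rewrite AY Yy.
apply/unit_ballP.
by move: y2; rewrite -{1}Yy Y2 gerDr pmulr_rle0 // subr_le0.
Qed.

Definition facet_center (R : realType) n (i : 'I_n.+1) : 'cV[R]_n.+1 :=
  \col_j ((j != i)%:R / n%:R).

(** The inner product of y with the facet center is (1 - y_i)/n, and the center has squared length
    1/n. The proof compares the two sides term by term. *)
Lemma facet_center_dist (R : realType) n (y : 'cV[R]_n.+1) i :
    (0 < n)%N -> \sum_j y j 0 = 1 ->
  \sum_j (y j 0 - facet_center R i j 0) ^+ 2 =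
    \sum_j y j 0 ^+ 2 - (1 - 2 * y i 0) / n%:R.
Proof.
move=> n_gt0 y1; have n0 : n%:R != 0 :> R by rewrite pnatr_eq0 -lt0n.
have -> : (1 - 2 * y i 0) / n%:R =
    \sum_j (j != i)%:R * (2 * y j 0 - n%:R^-1) / n%:R.
  rewrite -mulr_suml; congr (_ / _).
  transitivity (\sum_(j | j != i) (2 * y j 0 - n%:R^-1)).
    rewrite sumrB -mulr_sumr sumr_const cardC1 card_ord /=.
    rewrite -[_^-1 *+ _]mulr_natr mulVf //.
    by move: y1; rewrite (bigD1 i) //= => /(canRL (addKr _)) ->; ring.
  by rewrite big_mkcond; apply: eq_bigr => j _; case: (j != i); rewrite ?mul1r ?mul0r.
rewrite -sumrB; apply: eq_bigr => j _; rewrite mxE.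
by case: (j != i) => /=; field.
Qed.

(** In the ball the squared distance to the center of facet i is at most 2 y_i / n. Thus the ball
    lies in the simplex and meets each facet only at its center. *)
Lemma facet_center_uniq (R : realType) n (y : 'cV[R]_n.+1) i :
    (0 < n)%N -> \sum_j y j 0 = 1 -> \sum_j y j 0 ^+ 2 <= n%:R^-1 ->
  0 <= y i 0 /\ (y i 0 = 0 -> y = facet_center R i).
Proof.
move=> n_gt0 y1 y2; have nR_gt0 : 0 < n%:R :> R by rewrite ltr0n.
have dist_le : \sum_j (y j 0 - facet_center R i j 0) ^+ 2 <= 2 * y i 0 / n%:R.
  by rewrite facet_center_dist // mulrBl mul1r; lra.
split=> [|y0].
  have : 0 <= 2 * y i 0 / n%:R.
    by apply: le_trans dist_le; apply: sumr_ge0 => j _; apply: sqr_ge0.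
  by rewrite pmulr_lge0 ?invr_gt0 // pmulr_rge0.
rewrite y0 mulr0 mul0r in dist_le.
apply/colP => j; apply/eqP; rewrite -subr_eq0; apply/eqP.
exact: (sum_sqr_le0 (f := fun j => y j 0 - facet_center R i j 0)).
Qed.

Lemma facet_center_sum (R : realType) n (i : 'I_n.+1) :
  (0 < n)%N -> \sum_j facet_center R i j 0 = 1.
Proof.
move=> n_gt0; under eq_bigr do rewrite mxE.
rewrite (bigD1 i) //= eqxx mul0r add0r (eq_bigr (fun=> n%:R^-1)); last first.
  by move=> j ->; rewrite mul1r.
rewrite sumr_const cardC1 card_ord /= -[_^-1 *+ _]mulr_natr mulVf //.
by rewrite pnatr_eq0 -lt0n.
Qed.

Lemma facet_center_sum_sqr (R : realType) n (i : 'I_n.+1) :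
  (0 < n)%N -> \sum_j facet_center R i j 0 ^+ 2 = n%:R^-1.
Proof.
move=> n_gt0; have := facet_center_dist i n_gt0 (facet_center_sum R i n_gt0).
rewrite big1 => [|j _]; last by rewrite subrr expr0n.
rewrite [X in 2 * X]mxE eqxx mul0r mulr0 subr0 mul1r.
by move/eqP; rewrite eq_sym subr_eq0 => /eqP.
Qed.

(** * From ellipsoids in the data hull to ellipsoids in the simplex, and the contact points *)

(** Each F b with b in the unit ball is a difference of two points of the image of the simplex. So
    the columns of [B *m F] have sum 0 and are fixed by U U^T, which lets [F] factor through
    [A *m U]. *)
Lemma inscribed_factorization (R : realType) m n (A : 'M[R]_(m, n.+1))
    (B : 'M[R]_(n.+1, m)) (U : 'M[R]_(n.+1, n)) k (F : 'M[R]_(m, k)) c :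
    B *m A = 1%:M -> U *m U^T = 1%:M - const_mx n.+1%:R^-1 ->
    ellipsoid F c `<=` [set A *m y | y in @simplex R n.+1] ->
  [/\ F = A *m U *m (U^T *m B *m F), c = A *m (B *m c),
      \sum_i (B *m c) i 0 = 1
    & forall b : 'cV[R]_k, \sum_i b i 0 ^+ 2 <= 1 ->
        forall i, 0 <= (U *m (U^T *m B *m F) *m b + B *m c) i 0].
Proof.
move=> BA UUT subT.
have inT (b : 'cV[R]_k) : \sum_i b i 0 ^+ 2 <= 1 ->
    exists2 y, simplex y & A *m y = F *m b + c.
  by move=> b1; apply: subT; exists b => //; apply/unit_ballP.
have BA_ (y : 'cV[R]_n.+1) : B *m (A *m y) = y by rewrite mulmxA BA mul1mx.
have [y0 [_ y01] Ay0] : exists2 y, simplex y & A *m y = c.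
  have [|y yT] := inT 0; last by rewrite mulmx0 add0r; exists y.
  by rewrite big1 ?ler01 // => i _; rewrite mxE expr0n.
have Bc : B *m c = y0 by rewrite -Ay0 BA_.
have FE (b : 'cV[R]_k) : \sum_i b i 0 ^+ 2 <= 1 ->
    A *m (B *m (F *m b)) = F *m b /\ \sum_i (B *m (F *m b)) i 0 = 0.
  move=> /inT[y [_ y1] Ay].
  have -> : F *m b = A *m (y - y0) by rewrite mulmxBr Ay Ay0 addrK.
  rewrite BA_; split=> //; under eq_bigr do rewrite mxE [X in _ + X]mxE.
  by rewrite sumrB y1 y01 subrr.
(* Unit vectors belong to the ball, so [FE] applies to each column of [F]. *)
have delta1 (j : 'I_k) : \sum_i (delta_mx j 0 : 'cV[R]_k) i 0 ^+ 2 <= 1.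
  rewrite (bigD1 j) //= mxE !eqxx expr1n big1 ?addr0 // => i ij.
  by rewrite mxE (negPf ij) expr0n.
have ABF : A *m (B *m F) = F.
  apply/matrixP => i j; have [+ _] := FE _ (delta1 j).
  by rewrite !mulmxA -!colE => /colP/(_ i); rewrite !mxE.
have sumBF (j : 'I_k) : \sum_i (B *m F) i j = 0.
  have [_] := FE _ (delta1 j); rewrite mulmxA -colE => sum0; rewrite -[RHS]sum0.
  by apply: eq_bigr => i _; rewrite [RHS]mxE.
have UUTBF : U *m (U^T *m B *m F) = B *m F.
  rewrite -(mulmxA U^T) mulmxA UUT mulmxBl mul1mx.
  suff -> : const_mx n.+1%:R^-1 *m (B *m F) = 0 :> 'M_(n.+1, k) by rewrite subr0.
  apply/matrixP => i j; rewrite mxE [RHS]mxE.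
  transitivity (\sum_i n.+1%:R^-1 * (B *m F) i j).
    by apply: eq_bigr => l _; rewrite [X in X * _]mxE.
  by rewrite -mulr_sumr sumBF mulr0.
split.
- by rewrite -mulmxA UUTBF ABF.
- by rewrite Bc Ay0.
- by rewrite Bc.
- move=> b b1 i; have [y [y_ge0 _] Ay] := inT _ b1.
  by rewrite UUTBF -mulmxA -mulmxDr -Ay BA_.
Qed.

Lemma max_inscribed_ball (R : realType) m n (A : 'M[R]_(m, n.+1))
    (X : set 'cV[R]_m) :
    (0 < n)%N -> \rank A = n.+1 ->
    X `<=` [set A *m y | y in @simplex R n.+1] ->
    (forall y : 'cV[R]_n.+1, \sum_i y i 0 = 1 -> \sum_i y i 0 ^+ 2 <= n%:R^-1 ->
       X (A *m y)) ->
  let E0 := [set A *m y | y in [set y : 'cV[R]_n.+1 |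
    \sum_i y i 0 = 1 /\ \sum_i y i 0 ^+ 2 <= n%:R^-1]] in
  (exists (F : 'M[R]_(m, n)) c, max_inscribed X F c /\ E0 = ellipsoid F c) /\
  forall (F : 'M[R]_(m, n)) c, max_inscribed X F c ->
    c = A *m const_mx n.+1%:R^-1 /\ ellipsoid F c = E0.
Proof.
move=> n_gt0 rkA subT ballX E0.
have [B BA] := left_inverse_of_rank rkA.
have [U [UU UUT]] := ones_complement_basis R n.
have nN_gt0 : 0 < (n%:R * n.+1%:R)^-1 :> R by rewrite invr_gt0 mulr_gt0 ?ltr0n.
pose rho : R := Num.sqrt (n%:R * n.+1%:R)^-1.
have rho_gt0 : 0 < rho by rewrite sqrtr_gt0.
have rho2 : rho ^+ 2 * (n%:R * n.+1%:R) = 1.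
  by rewrite sqr_sqrtr ?ltW // mulVf // -invr_eq0 lt0r_neq0.
have E0E : ellipsoid (rho *: (A *m U)) (A *m const_mx n.+1%:R^-1) = E0.
  exact: ball_ellipsoid.
have rkW : \rank (A *m U) = n.
  apply/eqP; rewrite eqn_leq rank_leq_col /=.
  rewrite -[leqLHS](mxrank1 R) -UU -[U in leqLHS]mul1mx -BA -mulmxA mulmxA.
  exact: mxrankM_maxr.
have D_gt0 := gram_det_gt0 rkW; set D := \det _ in D_gt0.
(* All competitors share the positive factor [D], so only the squared determinants of the [H] have
   to be compared. *)
have det_factor (H : 'M_n) :
    \det ((A *m U *m H)^T *m (A *m U *m H)) = D * \det H ^+ 2.
  have -> : (A *m U *m H)^T *m (A *m U *m H) =
      H^T *m ((A *m U)^T *m (A *m U)) *m H by rewrite trmx_mul !mulmxA.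
  by rewrite det_mulmx (det_mulmx H^T) det_tr -/D mulrAC -expr2 mulrC.
pose F0 := rho *: (A *m U).
have detF0 : \det (F0^T *m F0) = D * rho ^+ n ^+ 2.
  have -> : F0 = A *m U *m rho%:M by rewrite mul_mx_scalar.
  by rewrite det_factor det_scalar.
have inscribed (F : 'M[R]_(m, n)) c : ellipsoid F c `<=` X ->
    [/\ \det (F^T *m F) <= \det (F0^T *m F0)
      & \det (F0^T *m F0) <= \det (F^T *m F) ->
        c = A *m const_mx n.+1%:R^-1 /\ ellipsoid F c = E0].
  move=> /(fun h => subset_trans h subT) FT.
  have [FE cE y1 ball] := inscribed_factorization BA UUT FT.
  have [le_det eq_det] := simplex_inscribed_ellipsoid UU UUT rho_gt0 rho2 y1 ball.
  have detF : \det (F^T *m F) = D * \det (U^T *m B *m F) ^+ 2.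
    by rewrite {1 2}FE det_factor.
  rewrite detF0 detF !ler_pM2l //; split=> // /eq_det[yE [Q [QQ HE]]].
  rewrite cE yE; split=> //; rewrite -E0E FE HE.
  apply/seteqP; split=> x [b /unit_ballP b1 <-].
    exists (Q *m b); first by apply/unit_ballP; rewrite sum_sqr_orthogonal.
    by rewrite -!scalemxAr -!scalemxAl !mulmxA.
  have QQT : Q *m Q^T = 1%:M by apply: mulmx1C.
  exists (Q^T *m b).
    by apply/unit_ballP; rewrite sum_sqr_orthogonal ?trmxK.
  by rewrite -!scalemxAr -!scalemxAl -!mulmxA (mulmxA Q) QQT mul1mx.
have E0X : E0 `<=` X by move=> _ [y [y1 y2] <-]; apply: ballX.
have F0X : ellipsoid F0 (A *m const_mx n.+1%:R^-1) `<=` X by rewrite E0E.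
split.
  exists F0, (A *m const_mx n.+1%:R^-1); split=> //.
  by split=> // F c /inscribed[].
by move=> F c [/inscribed[_ + maxF]]; apply; apply: maxF F0X.
Qed.

(** A ball point with positive coordinates is relatively interior because 1/n < r; a zero coordinate
    forces a facet center. Conversely, the line from the barycenter leaves the simplex at the facet
    center. *)
Lemma contact_facet_centers (R : realType) m n (A : 'M[R]_(m, n.+1))
    (B : 'M[R]_(n.+1, m)) (X : set 'cV[R]_m) r :
    (0 < n)%N -> B *m A = 1%:M ->
    X `<=` [set A *m y | y in @simplex R n.+1] ->
    (forall y, simplex y -> \sum_i y i 0 ^+ 2 <= r -> X (A *m y)) ->
    n%:R^-1 < r ->
  [set A *m y | y in [set y : 'cV[R]_n.+1 |
    \sum_i y i 0 = 1 /\ \sum_i y i 0 ^+ 2 <= n%:R^-1]] `&` rbd X =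
  range (fun i => A *m facet_center R i).
Proof.
move=> n_gt0 BA subT ballX rn.
have N0 : n.+1%:R != 0 :> R by rewrite pnatr_eq0.
have ball_simplex (y : 'cV[R]_n.+1) :
    \sum_i y i 0 = 1 -> \sum_i y i 0 ^+ 2 <= n%:R^-1 -> simplex y.
  by move=> y1 y2; split=> // i; case: (facet_center_uniq i n_gt0 y1 y2).
have ballX' (y : 'cV[R]_n.+1) :
    \sum_i y i 0 = 1 -> \sum_i y i 0 ^+ 2 <= n%:R^-1 -> X (A *m y).
  by move=> y1 y2; apply: ballX; [exact: ball_simplex | exact: le_trans (ltW rn)].
have subA : X `<=` [set A *m y | y in [set y : 'cV[R]_n.+1 | \sum_i y i 0 = 1]].
  by move=> x /subT[y [_ y1] <-]; exists y.
apply/seteqP; split=> x.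
  move=> [[y [y1 y2] <-] [_ not_relint]].
  have y_ge0 i := (facet_center_uniq i n_gt0 y1 y2).1.
  have [[i y0] | y_neq0] := pselect (exists i, y i 0 = 0).
    by exists i => //; rewrite -(facet_center_uniq i n_gt0 y1 y2).2.
  case: not_relint; apply: relint_mulmx BA subA ballX _ y1 _.
    by move=> i; rewrite lt_def y_ge0 andbT; apply/eqP => y0; apply: y_neq0; exists i.
  exact: le_lt_trans rn.
move=> [i _ <-].
have p1 := facet_center_sum R i n_gt0; have p2 := facet_center_sum_sqr R i n_gt0.
have Xp : X (A *m facet_center R i) by apply: ballX'; rewrite ?p2.
split; first by exists (facet_center R i) => //; rewrite /= p2.
split; first exact: subset_closure.
pose z : 'cV[R]_n.+1 := const_mx n.+1%:R^-1.
have Xz : X (A *m z).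
  apply: ballX'.
    under eq_bigr do rewrite mxE.
    by rewrite sumr_const card_ord -[LHS]mulr_natr mulVf.
  under eq_bigr do rewrite mxE.
  rewrite sumr_const card_ord -[leLHS]mulr_natr expr2 -mulrA mulVf // mulr1.
  by rewrite lef_pV2 ?posrE ?ltr0n // ler_nat.
(* Coordinate i is 0 at the facet center and 1/(n + 1) at [z], hence -t/(n + 1) at the point
   beyond. *)
apply: (not_relint_of_line Xp Xz) => t t_gt0 /subT[y [y_ge0 _]].
rewrite -mulmxBr scalemxAr -mulmxDr => /(congr1 (mulmx B)).
rewrite !mulmxA BA !mul1mx => yE; have := y_ge0 i.
rewrite yE !mxE eqxx mul0r add0r sub0r mulrN oppr_ge0 pmulr_rle0 //.
by rewrite leNgt invr_gt0 ltr0n.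
Qed.

(** * Recovery of the columns from the optimal ellipsoid *)

Theorem corollary1 (R : realType) (M N L : nat)
    (A : 'M[R]_(M, N)) (S : 'M[R]_(N, L))
    (hN : (N <= minn M L)%N)
    (A1 : forall i : 'I_L, (forall j, 0 <= S j i) /\ \sum_j S j i = 1)
    (A2 : \rank A = N)
    (A3 : \rank S = N)
    (hN3 : (3 <= N)%N)
    (hgamma : 1 / Num.sqrt (N.-1%:R : R) < purity (fun i : 'I_L => col i S)) :
  let x := fun i : 'I_L => A *m col i S in
  let X := conv x in
  let abar := N%:R^-1 *: \sum_(i < N) col i A in
  (exists! E : set 'cV[R]_M,
     exists (F : 'M[R]_(M, N.-1)) (c : 'cV[R]_M),
       max_inscribed X F c /\ E = ellipsoid F c) /\
  forall (F : 'M[R]_(M, N.-1)) (c : 'cV[R]_M),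
    max_inscribed X F c ->
    c = abar /\
    exists q : 'I_N -> 'cV[R]_M,
      [/\ injective q,
          ellipsoid F c `&` rbd X = range q,
          forall i, col i A = N%:R *: abar - N.-1%:R *: q i
        & forall i, col i A = \sum_(j < N) q j - N.-1%:R *: q i].
Proof.
move=> x X abar.
case: N A S hN A1 A2 A3 hN3 hgamma @x @X @abar => [|n] // A S _ A1 rkA _ hN3.
rewrite [n.+1.-1]/= => hgamma x X abar.
have n_gt0 : (0 < n)%N by rewrite -ltnS; apply: leq_trans hN3.
have n0 : n%:R != 0 :> R by rewrite pnatr_eq0 -lt0n.
have N0 : n.+1%:R != 0 :> R by rewrite pnatr_eq0.
have [B BA] := left_inverse_of_rank rkA.
have r0_ge0 : 0 <= 1 / Num.sqrt (n%:R : R) by rewrite divr_ge0 // sqrtr_ge0.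
have [r r0r ball_conv] := purity_ball r0_ge0 hgamma.
have nr : n%:R^-1 < r ^+ 2.
  have -> : n%:R^-1 = (1 / Num.sqrt (n%:R : R)) ^+ 2.
    by rewrite mul1r exprVn sqr_sqrtr ?ler0n.
  by rewrite ltr_sqr ?nnegrE // ltW // (le_lt_trans r0_ge0).
have XE : X = [set A *m y | y in conv (fun i => col i S)] by exact: conv_mulmx.
have subT : X `<=` [set A *m y | y in @simplex R n.+1].
  rewrite XE; apply: image_subset; apply: conv_sub_simplex => i.
  have [S_ge0 S1] := A1 i; split=> [j|]; first by rewrite mxE.
  by under eq_bigr do rewrite mxE.
have ballX (y : 'cV[R]_n.+1) :
    simplex y -> \sum_i y i 0 ^+ 2 <= r ^+ 2 -> X (A *m y).
  by move=> yT y2; rewrite XE; exists y => //; apply: ball_conv.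
have insballX (y : 'cV[R]_n.+1) :
    \sum_i y i 0 = 1 -> \sum_i y i 0 ^+ 2 <= n%:R^-1 -> X (A *m y).
  move=> y1 y2; apply: ballX; last exact: le_trans (ltW nr).
  by split=> // i; case: (facet_center_uniq i n_gt0 y1 y2).
have [[F0 [c0 [max0 E0E]]] max_uniq] := max_inscribed_ball n_gt0 rkA subT insballX.
have sum_col : \sum_(i < n.+1) col i A = A *m const_mx 1.
  apply/colP => i; rewrite summxE mxE; apply: eq_bigr => j _.
  by rewrite !mxE mulr1.
have abarE : abar = A *m const_mx n.+1%:R^-1.
  rewrite /abar sum_col scalemxAr; congr (_ *m _).
  by apply/colP => i; rewrite !mxE mulr1.
split.
  eexists; split; first by exists F0, c0.
  by move=> E [F [c [/max_uniq[_ +] ->]]]; rewrite -E0E => ->.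
move=> F c /max_uniq[-> ->]; split; first by rewrite abarE.
pose q i := A *m facet_center R i.
have Nabar : n.+1%:R *: abar = A *m const_mx 1.
  by rewrite scalerA divff // scale1r sum_col.
(* In coordinates, n times the center of facet i is the all-one vector minus the unit vector i. *)
have col_q i : col i A = n.+1%:R *: abar - n%:R *: q i.
  rewrite Nabar scalemxAr -mulmxBr colE; congr (_ *m _).
  apply/colP => j; rewrite !mxE eqxx andbT mulrC divfK //.
  by case: eqP; rewrite ?subr0 ?subrr.
(* The array of facet centers is symmetric in its two indices, so summing over the centers gives 1
   in every coordinate. *)
have sum_q : \sum_j q j = n.+1%:R *: abar.
  rewrite -mulmx_sumr Nabar; congr (_ *m _).
  apply/colP => j; rewrite summxE mxE -[RHS](facet_center_sum R j n_gt0).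
  by apply: eq_bigr => i _; rewrite !mxE eq_sym.
exists q; split=> //; last by move=> i; rewrite sum_q.
(* Only the center of facet i has a zero in coordinate i. *)
- move=> i j /(congr1 (mulmx B)); rewrite !mulmxA BA !mul1mx => /colP/(_ i).
  rewrite !mxE eqxx mul0r => /esym/eqP; rewrite mulf_eq0 invr_eq0 (negPf n0) orbF.
  by rewrite pnatr_eq0 eqb0 negbK => /eqP.
- exact: contact_facet_centers n_gt0 BA subT ballX nr.
Qed.
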